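(* Let $k$ be a commutative associative unital ring and let $H$ be a proper quantum group over $k$, i.e. a Hopf algebra over $k$ that is neither commutative nor cocommutative. Then $k \subseteq H$ is a Hopf--Galois extension by the bialgebra $H$, with respect to the coaction $\delta = \Delta : H \to H \otimes H$ of $H$ on itself given by the comultiplication.
   Context: All tensor products without subscript are over $k$; algebras are associative and unital. A $k$-bialgebra is $(H,\mu,\eta,\Delta,\varepsilon)$ with $(H,\mu,\eta)$ a $k$-algebra, $(H,\Delta,\varepsilon)$ a coassociative counital $k$-coalgebra, and $\Delta,\varepsilon$ unital algebra homomorphisms. A bialgebra is a Hopf algebra if there is a $k$-linear map $S: H\to H$ (antipode) with $\mu(S\otimes \mathrm{id}_H)\Delta = \eta\varepsilon = \mu(\mathrm{id}_H\otimes S)\Delta$. $H$ is cocommutative if $\tau\circ\Delta=\Delta$, where $\tau(x\otimes y)=y\otimes x$. An algebra coaction of a bialgebra $H$ on a $k$-algebra $A$ is a unital algebra homomorphism $\delta: A\to A\otimes H$, written $\delta(a)=a_{(0)}\otimes a_{(1)}$, with $(\delta\otimes \mathrm{id}_H)\delta=(\mathrm{id}_A\otimes\Delta)\delta$ and $(\mathrm{id}_A\otimes\varepsilon)\delta=\mathrm{id}_A$. Its coinvariant subalgebra is $A^{\mathrm{co}\,H}=\{a\in A:\delta(a)=a\otimes 1_H\}$. With $B=A^{\mathrm{co}\,H}$, the canonical map is the $k$-linear map $\mathrm{can}: A\otimes_B A\to A\otimes H$, $a\otimes_B c\mapsto a\,\delta(c)=a c_{(0)}\otimes c_{(1)}$.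 One says $B\subseteq A$ is a Hopf--Galois extension by $H$ if $\mathrm{can}$ is bijective. For $A=H$ and $\delta=\Delta$ one has $H^{\mathrm{co}\,H}=k\cdot 1_H$, identified with $k$, and the canonical map is $\mathrm{can}_H: H\otimes H\to H\otimes H$, $h\otimes h'\mapsto h h'_{(1)}\otimes h'_{(2)}$, where $\Delta(h')=h'_{(1)}\otimes h'_{(2)}$ (Sweedler notation). *)

(* Defs.v *)
From HB Require Import structures.
From mathcomp Require Import all_boot all_algebra.
From mathcomp Require Import boolp.

Set Implicit Arguments.
Unset Strict Implicit.
Unset Printing Implicit Defensive.

Import GRing.Theory.
Local Open Scope ring_scope.
Local Open Scope quotient_scope.

(* The elements of [btens ract lact] are the formal sums
  m_1 (x) n_1 + ... + m_r (x) n_r, encoded as sequences of pairs, modulo the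
  least congruence making (x) biadditive and balanced, i.e.
  (m . i) (x) n = m (x) (i . n).  The index type [I] is the carrier of the ring
  over which the tensor product is formed, acting on the right of [M] and on
  the left of [N].  The free commutative monoid is used instead of the free
  abelian group: the relation 0 (x) n = 0 makes - m (x) n an opposite of
  m (x) n, so the quotients coincide. *)

Section BalancedTensor.
Context {k : comPzRingType} {M : lmodType k} {N : zmodType} {I : Type}.
Variables (ract : I -> {linear M -> M}) (lact : I -> {additive N -> N}).

Inductive tens_eqv : seq (M * N) -> seq (M * N) -> Prop :=
| TensRefl s : tens_eqv s s
| TensSym s t : tens_eqv s t -> tens_eqv t s
| TensTrans s t u : tens_eqv s t -> tens_eqv t u -> tens_eqv s u
| TensCat s1 t1 s2 t2 :
    tens_eqv s1 t1 -> tens_eqv s2 t2 -> tens_eqv (s1 ++ s2) (t1 ++ t2)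
| TensCatC s t : tens_eqv (s ++ t) (t ++ s)
| Tens0l n : tens_eqv [:: (0, n)] [::]
| TensDl m m' n : tens_eqv [:: (m + m', n)] [:: (m, n); (m', n)]
| TensDr m n n' : tens_eqv [:: (m, n + n')] [:: (m, n); (m, n')]
| TensBal m i n : tens_eqv [:: (ract i m, n)] [:: (m, lact i n)].

Let eqv (s t : seq (M * N)) : bool := `[< tens_eqv s t >].

Fact tens_eqv_equiv : equiv_class_of eqv.
Proof.
split=> [s|s t|t s u]; first by apply/asboolP; exact: TensRefl.
- by apply/asboolP/asboolP; exact: TensSym.
- by move=> /asboolP st /asboolP tu; apply/asboolP; exact: TensTrans st tu.
Qed.

Canonical tens_eqv_equiv_rel := EquivRelPack tens_eqv_equiv.

Definition btens := {eq_quot tens_eqv_equiv_rel}.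

HB.instance Definition _ := EqQuotient.on btens.
HB.instance Definition _ := Choice.on btens.

Definition cls (s : seq (M * N)) : btens := \pi_btens s.

Let cls_eqP s t : reflect (cls s = cls t) (eqv s t).
Proof. exact: (@eqquotP _ _ btens). Qed.

Let cls_eq s t : tens_eqv s t -> cls s = cls t.
Proof. by move=> st; apply/cls_eqP/asboolP. Qed.

Let cls_repr s : tens_eqv (repr (cls s)) s.
Proof. by apply/asboolP/cls_eqP; exact: (reprK (cls s)). Qed.

Let clsP (P : btens -> Prop) : (forall s, P (cls s)) -> forall x, P x.
Proof. by move=> Ps x; rewrite -(reprK x); exact: Ps. Qed.

Definition pure (m : M) (n : N) : btens := cls [:: (m, n)].

Definition btens_add (x y : btens) : btens := cls (repr x ++ repr y).
Definition btens_opp (x : btens) : btens :=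
  cls [seq (- p.1, p.2) | p <- repr x].
Definition btens_scale (c : k) (x : btens) : btens :=
  cls [seq (c *: p.1, p.2) | p <- repr x].

Let eqv_map (f : {additive M -> M}) : (forall i m, f (ract i m) = ract i (f m)) ->
  forall s t, tens_eqv s t ->
  tens_eqv [seq (f p.1, p.2) | p <- s] [seq (f p.1, p.2) | p <- t].
Proof.
move=> fr s t; elim=> {s t} /=.
- by move=> s; exact: TensRefl.
- by move=> s t _; exact: TensSym.
- by move=> s t u _ st _; exact: TensTrans.
- by move=> s1 t1 s2 t2 _ h1 _ h2; rewrite !map_cat; exact: TensCat.
- by move=> s t; rewrite !map_cat; exact: TensCatC.
- by move=> n; rewrite raddf0; exact: Tens0l.
- by move=> m m' n; rewrite raddfD; exact: TensDl.
- by move=> m n n'; exact: TensDr.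
- by move=> m i n; rewrite fr; exact: TensBal.
Qed.

Let addE s t : btens_add (cls s) (cls t) = cls (s ++ t).
Proof. by apply: cls_eq; apply: TensCat; exact: cls_repr. Qed.

Let oppE s : btens_opp (cls s) = cls [seq (- p.1, p.2) | p <- s].
Proof.
apply: cls_eq; apply: (eqv_map (f := -%R)); last exact: cls_repr.
by move=> i m; rewrite raddfN.
Qed.

Let scaleE c s : btens_scale c (cls s) = cls [seq (c *: p.1, p.2) | p <- s].
Proof.
apply: cls_eq; apply: (eqv_map (f := *:%R c)); last exact: cls_repr.
by move=> i m; rewrite linearZ.
Qed.

Fact btens_addA : associative btens_add.
Proof.
by elim/clsP=> s; elim/clsP=> t; elim/clsP=> u; rewrite !addE catA.
Qed.

Fact btens_addC : commutative btens_add.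
Proof.
by elim/clsP=> s; elim/clsP=> t; rewrite !addE; apply: cls_eq; exact: TensCatC.
Qed.

Fact btens_add0 : left_id (cls [::]) btens_add.
Proof. by elim/clsP=> s; rewrite addE. Qed.

Fact btens_addN : left_inverse (cls [::]) btens_opp btens_add.
Proof.
elim/clsP=> s; rewrite oppE addE; elim: s => [//|[m n] s IHs] /=.
set s' := map _ s.
have ACA a b c d : btens_add (btens_add a b) (btens_add c d)
    = btens_add (btens_add a c) (btens_add b d).
  by rewrite -!btens_addA (btens_addA b) (btens_addC b) !btens_addA.
rewrite -cat1s -(cat1s (m, n)) catA -!addE ACA.
rewrite (addE s' s) IHs btens_addC btens_add0 addE.
rewrite -(cls_eq (Tens0l n)) -(addNr m).
by apply/esym/cls_eq; exact: TensDl.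
Qed.

HB.instance Definition _ := GRing.isZmodule.Build btens
  btens_addA btens_addC btens_add0 btens_addN.

Let cls_cat s t : cls (s ++ t) = cls s + cls t.
Proof. by rewrite -addE. Qed.

Let clsE s : cls s = \sum_(p <- s) pure p.1 p.2.
Proof.
elim: s => [|[m n] s IHs]; first by rewrite big_nil.
by rewrite -cat1s cls_cat IHs big_cons.
Qed.

Lemma btensE (x : btens) : x = \sum_(p <- repr x) pure p.1 p.2.
Proof. by rewrite -clsE /cls reprK. Qed.

Lemma btens_ind (P : btens -> Prop) :
    P 0 -> (forall x y, P x -> P y -> P (x + y)) ->
  (forall m n, P (pure m n)) -> forall x, P x.
Proof. by move=> P0 PD Pp x; rewrite (btensE x); apply: big_ind. Qed.

Lemma pureDl m m' n : pure (m + m') n = pure m n + pure m' n.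
Proof. by rewrite -cls_cat; apply: cls_eq; exact: TensDl. Qed.

Lemma pureDr m n n' : pure m (n + n') = pure m n + pure m n'.
Proof. by rewrite -cls_cat; apply: cls_eq; exact: TensDr. Qed.

Lemma pure_bal m i n : pure (ract i m) n = pure m (lact i n).
Proof. by apply: cls_eq; exact: TensBal. Qed.

Lemma pure0l n : pure 0 n = 0.
Proof. by apply: cls_eq; exact: Tens0l. Qed.

Lemma pure0r m : pure m 0 = 0.
Proof. by apply: (addrI (pure m 0)); rewrite -pureDr !addr0. Qed.

Let scale_pure c m n : btens_scale c (pure m n) = pure (c *: m) n.
Proof. exact: scaleE. Qed.

Fact btens_scaleDr : right_distributive btens_scale +%R.
Proof.
by move=> c; elim/clsP=> s; elim/clsP=> t; rewrite -cls_cat !scaleE map_cat cls_cat.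
Qed.

Let scale0 c : btens_scale c 0 = 0.
Proof. exact: scaleE. Qed.

Fact btens_scaleA c d x :
  btens_scale c (btens_scale d x) = btens_scale (c * d) x.
Proof.
by elim/btens_ind: x => [|x y ex ey|m n]; rewrite ?scale0 // ?btens_scaleDr ?ex ?ey // !scale_pure scalerA.
Qed.

Fact btens_scale1 : left_id 1 btens_scale.
Proof.
by elim/btens_ind=> [|x y ex ey|m n]; rewrite ?scale0 // ?btens_scaleDr ?ex ?ey // !scale_pure scale1r.
Qed.

Fact btens_scaleDl x : {morph btens_scale^~ x : c d / c + d >-> c + d}.
Proof.
move=> c d; elim/btens_ind: x => [|x y ex ey|m n].
- by rewrite !scale0 addr0.
- by rewrite !btens_scaleDr ex ey addrACA.
- by rewrite !scale_pure scalerDl pureDl.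
Qed.

HB.instance Definition _ := GRing.Zmodule_isLmodule.Build k btens
  btens_scaleA btens_scale1 btens_scaleDr btens_scaleDl.

Lemma pureZl c m n : pure (c *: m) n = c *: pure m n.
Proof. by rewrite -scale_pure. Qed.

(* Meaningful only for biadditive balanced [f]; see [lift_pure]. *)
Definition lift (P : zmodType) (f : M -> N -> P) (x : btens) : P :=
  \sum_(p <- repr x) f p.1 p.2.

Record balanced (P : zmodType) (f : M -> N -> P) : Prop := Balanced {
  balDl : forall m m' n, f (m + m') n = f m n + f m' n;
  balDr : forall m n n', f m (n + n') = f m n + f m n';
  bal_act : forall m i n, f (ract i m) n = f m (lact i n) }.

Section Lift.
Variables (P : zmodType) (f : M -> N -> P).
Hypothesis fb : balanced f.

Let lift_eqv s t :
  tens_eqv s t -> \sum_(p <- s) f p.1 p.2 = \sum_(p <- t) f p.1 p.2.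
Proof.
elim=> {s t} //.
- by move=> s t u _ -> _ ->.
- by move=> s1 t1 s2 t2 _ e1 _ e2; rewrite !big_cat /= e1 e2.
- by move=> s t; rewrite !big_cat /= addrC.
- move=> n; rewrite big_seq1 big_nil /=.
  by apply: (addrI (f 0 n)); rewrite -balDl // !addr0.
- by move=> m m' n; rewrite !big_cons !big_nil !addr0 /= balDl.
- by move=> m n n'; rewrite !big_cons !big_nil !addr0 /= balDr.
- by move=> m i n; rewrite !big_seq1 /= bal_act.
Qed.

Let lift_cls s : lift f (cls s) = \sum_(p <- s) f p.1 p.2.
Proof. by apply: lift_eqv; exact: cls_repr. Qed.

Lemma lift_pure m n : lift f (pure m n) = f m n.
Proof. by rewrite [LHS]lift_cls big_seq1. Qed.

Lemma liftD : {morph lift f : x y / x + y}.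
Proof.
by elim/clsP=> s; elim/clsP=> t; rewrite -cls_cat !lift_cls big_cat.
Qed.

Lemma lift0 : lift f 0 = 0.
Proof. by apply: (addrI (lift f 0)); rewrite -liftD !addr0. Qed.

End Lift.

End BalancedTensor.

Definition tensor (k : comPzRingType) (M N : lmodType k) : Type :=
  @btens k M N k (fun c => *:%R c) (fun c => *:%R c).
Arguments tensor {k} (M N)%_type.

HB.instance Definition _ (k : comPzRingType) (M N : lmodType k) :=
  GRing.Lmodule.on (tensor M N).

Notation "M ⊗ N" := (tensor M N) (at level 40, left associativity) : type_scope.

Definition tens (k : comPzRingType) (M N : lmodType k) (m : M) (n : N) : M ⊗ N :=
  pure _ _ m n.

Notation "m ⊗ n" := (tens m n) (at level 40, left associativity) : ring_scope.

Section TensorMaps.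
Context {k : comPzRingType}.
Implicit Types M N P : lmodType k.

Lemma tensDl M N (m m' : M) (n : N) : (m + m') ⊗ n = m ⊗ n + m' ⊗ n.
Proof. exact: pureDl. Qed.

Lemma tensDr M N (m : M) (n n' : N) : m ⊗ (n + n') = m ⊗ n + m ⊗ n'.
Proof. exact: pureDr. Qed.

Lemma tens0l M N (n : N) : (0 : M) ⊗ n = 0.
Proof. exact: pure0l. Qed.

Lemma tens0r M N (m : M) : m ⊗ (0 : N) = 0.
Proof. exact: pure0r. Qed.

Lemma tensZl M N c (m : M) (n : N) : (c *: m) ⊗ n = c *: (m ⊗ n).
Proof. exact: pureZl. Qed.

Lemma tensZr M N c (m : M) (n : N) : m ⊗ (c *: n) = c *: (m ⊗ n).
Proof. by rewrite -tensZl; apply/esym; exact: pure_bal. Qed.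

Lemma tensor_ind M N (P : M ⊗ N -> Prop) :
    P 0 -> (forall x y, P x -> P y -> P (x + y)) ->
  (forall m n, P (m ⊗ n)) -> forall x, P x.
Proof. exact: btens_ind. Qed.

(* For k-bilinear [f], the map induced by the universal property of the tensor
   product; see [tlift_tens] and [tlift_linear]. *)
Definition tlift M N (P : zmodType) (f : M -> N -> P) (x : M ⊗ N) : P :=
  lift f x.

Definition kbalanced M N (P : zmodType) (f : M -> N -> P) : Prop :=
  balanced (fun c => *:%R c) (fun c => *:%R c) f.

Section Tlift.
Variables (M N : lmodType k) (P : zmodType) (f : M -> N -> P).
Hypothesis fb : kbalanced f.

Lemma tlift_tens m n : tlift f (m ⊗ n) = f m n.
Proof. exact: lift_pure. Qed.

Lemma tliftD : {morph tlift f : x y / x + y}.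
Proof. exact: liftD. Qed.

Lemma tlift0 : tlift f 0 = 0.
Proof. exact: lift0. Qed.

End Tlift.

Lemma tlift_linear M N P (f : M -> N -> P) : kbalanced f ->
  (forall c m n, f (c *: m) n = c *: f m n) -> linear (tlift f).
Proof.
move=> fb fZ c x y; rewrite tliftD //; congr (_ + _).
elim/tensor_ind: x => [|x1 x2 e1 e2|m n].
- by rewrite scaler0 tlift0 // scaler0.
- by rewrite scalerDr !tliftD // e1 e2 scalerDr.
- by rewrite -tensZl !tlift_tens.
Qed.

Definition tmap M N M' N' (f : M -> M') (g : N -> N') : M ⊗ N -> M' ⊗ N' :=
  tlift (fun m n => f m ⊗ g n).

Lemma tmap_balanced M N M' N' (f : {linear M -> M'}) (g : {linear N -> N'}) :
  kbalanced (fun m n => f m ⊗ g n).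
Proof.
split=> [m m' n|m n n'|m c n].
- by rewrite linearD tensDl.
- by rewrite linearD tensDr.
- by rewrite !linearZ /= tensZl tensZr.
Qed.

Lemma tmap_tens M N M' N' (f : {linear M -> M'}) (g : {linear N -> N'}) m n :
  tmap f g (m ⊗ n) = f m ⊗ g n.
Proof. exact: tlift_tens (tmap_balanced f g) m n. Qed.

Lemma tmap_linear M N M' N' (f : {linear M -> M'}) (g : {linear N -> N'}) :
  linear (tmap f g).
Proof.
apply: tlift_linear; first exact: tmap_balanced.
by move=> c m n; rewrite linearZ /= tensZl.
Qed.

Definition tassoc M N P : (M ⊗ N) ⊗ P -> M ⊗ (N ⊗ P) :=
  tlift (fun t p => tlift (fun m n => m ⊗ (n ⊗ p)) t).

Let tassoc_balanced1 M N P (p : P) :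
  kbalanced (fun (m : M) (n : N) => m ⊗ (n ⊗ p)).
Proof.
split=> [m m' n|m n n'|m c n].
- by rewrite tensDl.
- by rewrite tensDl tensDr.
- by rewrite !tensZl tensZr.
Qed.

Let tassoc_linear1 M N P (p : P) :
  linear (tlift (fun (m : M) (n : N) => m ⊗ (n ⊗ p))).
Proof.
by apply: tlift_linear; [exact: tassoc_balanced1 | move=> c m n; rewrite tensZl].
Qed.

Lemma tassoc_balanced M N P :
  kbalanced (fun (t : M ⊗ N) (p : P) => tlift (fun m n => m ⊗ (n ⊗ p)) t).
Proof.
split=> [t t' p|t p p'|t c p].
- by rewrite (tliftD (@tassoc_balanced1 _ _ _ _)).
- rewrite /=; elim/tensor_ind: t => [|x y ex ey|m n].
  + by rewrite !tlift0 ?addr0 //; exact: tassoc_balanced1.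
  + by rewrite !(tliftD (@tassoc_balanced1 _ _ _ _)) ex ey addrACA.
  + by rewrite !(tlift_tens (@tassoc_balanced1 _ _ _ _)) !tensDr.
- rewrite /=; elim/tensor_ind: t => [|x y ex ey|m n].
  + by rewrite scaler0 !tlift0 //; exact: tassoc_balanced1.
  + by rewrite scalerDr !(tliftD (@tassoc_balanced1 _ _ _ _)) ex ey.
  + by rewrite -tensZl !(tlift_tens (@tassoc_balanced1 _ _ _ _)) !tensZl !tensZr.
Qed.

Lemma tassoc_tens M N P (m : M) (n : N) (p : P) :
  tassoc (m ⊗ n ⊗ p) = m ⊗ (n ⊗ p).
Proof.
by rewrite /tassoc (tlift_tens (@tassoc_balanced M N P)) (tlift_tens (@tassoc_balanced1 _ _ _ p)).
Qed.

Lemma tassoc_linear M N P : linear (@tassoc M N P).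
Proof.
apply: tlift_linear; first exact: tassoc_balanced.
move=> c t p; have := @tassoc_linear1 _ _ _ p c t 0.
by rewrite addr0 (tlift0 (@tassoc_balanced1 _ _ _ p)) addr0.
Qed.

Definition tswap M N : M ⊗ N -> N ⊗ M := tlift (fun m n => n ⊗ m).

Lemma tswap_balanced M N : kbalanced (fun (m : M) (n : N) => n ⊗ m).
Proof.
split=> [m m' n|m n n'|m c n]; [exact: tensDr | exact: tensDl |].
by rewrite tensZl tensZr.
Qed.

Lemma tswap_tens M N (m : M) (n : N) : tswap (m ⊗ n) = n ⊗ m.
Proof. exact: tlift_tens (@tswap_balanced M N) m n. Qed.

Definition tlunit M : k^o ⊗ M -> M := tlift (fun (c : k^o) m => (c : k) *: m).
Definition trunit M : M ⊗ k^o -> M := tlift (fun m (c : k^o) => (c : k) *: m).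

Lemma tlunit_tens M (c : k^o) (m : M) : tlunit (c ⊗ m) = (c : k) *: m.
Proof.
apply: tlift_tens; split=> [a b x|a x y|a b x]; first exact: scalerDl.
- exact: scalerDr.
- by rewrite scalerA mulrC.
Qed.

Lemma trunit_tens M (m : M) (c : k^o) : trunit (m ⊗ c) = (c : k) *: m.
Proof.
apply: tlift_tens; split=> [x y a|x a b|x a b]; first exact: scalerDr.
- exact: scalerDl.
- by rewrite !scalerA mulrC.
Qed.

End TensorMaps.

Section TensorAlgebra.
Context {k : comPzRingType} {A C : algType k}.
Implicit Types (a : A) (c : C) (x y z : A ⊗ C).

Definition tens_mul x y : A ⊗ C :=
  tlift (fun a c => tlift (fun a' c' => (a * a') ⊗ (c * c')) y) x.

Let mul_balanced1 a c :
  kbalanced (fun (a' : A) (c' : C) => (a * a') ⊗ (c * c')).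
Proof.
split=> [m m' n|m n n'|m r n].
- by rewrite mulrDr tensDl.
- by rewrite mulrDr tensDr.
- by rewrite -!scalerAr tensZl tensZr.
Qed.

Let mul_balanced y :
  kbalanced (fun a c => tlift (fun a' c' => (a * a') ⊗ (c * c')) y).
Proof.
split=> [m m' n|m n n'|m r n]; elim/(@tensor_ind k A C): y => [|x y ex ey|a c];
  rewrite ?(tlift0 (mul_balanced1 _ _)) ?addr0 //;
  rewrite ?(tliftD (mul_balanced1 _ _)) ?ex ?ey 1?addrACA //;
  rewrite !(tlift_tens (mul_balanced1 _ _)).
- by rewrite mulrDl tensDl.
- by rewrite mulrDl tensDr.
- by rewrite -!scalerAl tensZl tensZr.
Qed.

Lemma tens_mulE a c a' c' :
  tens_mul (a ⊗ c) (a' ⊗ c') = (a * a') ⊗ (c * c').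
Proof.
by rewrite /tens_mul (tlift_tens (mul_balanced _)) (tlift_tens (mul_balanced1 _ _)).
Qed.

Fact tens_mulDl : left_distributive tens_mul +%R.
Proof. by move=> x y z; exact: tliftD. Qed.

Let mul0 y : tens_mul 0 y = 0.
Proof. exact: tlift0. Qed.

Fact tens_mulDr : right_distributive tens_mul +%R.
Proof.
move=> x y z; elim/(@tensor_ind k A C): x => [|x1 x2 e1 e2|a c].
- by rewrite !mul0 addr0.
- by rewrite !tens_mulDl e1 e2 addrACA.
- by rewrite /tens_mul !(tlift_tens (mul_balanced _)) (tliftD (mul_balanced1 _ _)).
Qed.

Let mulr0 x : tens_mul x 0 = 0.
Proof. by apply: (addrI (tens_mul x 0)); rewrite -tens_mulDr !addr0. Qed.

Fact tens_mulA : associative tens_mul.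
Proof.
move=> x y z; elim/(@tensor_ind k A C): x => [|x1 x2 e1 e2|a c].
- by rewrite !mul0.
- by rewrite !tens_mulDl e1 e2.
elim/(@tensor_ind k A C): y => [|x1 x2 e1 e2|a' c'].
- by rewrite !(mul0, mulr0).
- by rewrite !(tens_mulDl, tens_mulDr) e1 e2.
elim/(@tensor_ind k A C): z => [|x1 x2 e1 e2|a2 c2].
- by rewrite !mulr0.
- by rewrite !tens_mulDr e1 e2.
- by rewrite !tens_mulE !mulrA.
Qed.

Fact tens_mul1 : left_id (1 ⊗ 1) tens_mul.
Proof.
elim/(@tensor_ind k A C)=> [|x y ex ey|a c]; first by rewrite mulr0.
- by rewrite tens_mulDr ex ey.
- by rewrite tens_mulE !mul1r.
Qed.

Fact tens_mulr1 : right_id (1 ⊗ 1) tens_mul.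
Proof.
elim/(@tensor_ind k A C)=> [|x y ex ey|a c]; first by rewrite mul0.
- by rewrite tens_mulDl ex ey.
- by rewrite tens_mulE !mulr1.
Qed.

HB.instance Definition _ := GRing.Zmodule_isPzRing.Build (A ⊗ C)%type
  tens_mulA tens_mul1 tens_mulr1 tens_mulDl tens_mulDr.

Lemma tensM a c a' c' : (a ⊗ c) * (a' ⊗ c') = (a * a') ⊗ (c * c').
Proof. exact: tens_mulE. Qed.

Lemma tens11 : 1 ⊗ 1 = 1 :> A ⊗ C. Proof. by []. Qed.

End TensorAlgebra.

Definition tmult (k : comPzRingType) (A : algType k) : A ⊗ A -> A :=
  tlift *%R.

Lemma tmult_tens (k : comPzRingType) (A : algType k) (a b : A) :
  tmult (a ⊗ b) = a * b.
Proof.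
apply: tlift_tens; split=> [x y z|x y z|x c z]; first exact: mulrDl.
- exact: mulrDr.
- by rewrite -scalerAl -scalerAr.
Qed.

HB.mixin Record isCoalgebra (k : comPzRingType) C of GRing.Lmodule k C := {
  comul : {linear C -> (C ⊗ C)%type};
  counit : {linear C -> k^o};
  comulA : forall x : C,
    tassoc (tmap comul idfun (comul x)) = tmap idfun comul (comul x);
  counitl : forall x : C, tlunit (tmap counit idfun (comul x)) = x;
  counitr : forall x : C, trunit (tmap idfun counit (comul x)) = x
}.

#[short(type="coalgType")]
HB.structure Definition Coalgebra (k : comPzRingType) :=
  {C of isCoalgebra k C & GRing.Lmodule k C}.

HB.mixin Record Coalgebra_isBialgebra (k : comPzRingType) H
    of Coalgebra k H & GRing.Algebra k H := {
  comul_monoid_morphism : monoid_morphism (comul : H -> H ⊗ H);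
  counit_monoid_morphism : monoid_morphism (counit : H -> k)
}.

#[short(type="bialgType")]
HB.structure Definition Bialgebra (k : comPzRingType) :=
  {H of Coalgebra_isBialgebra k H & Coalgebra k H & GRing.Algebra k H}.

Section Hopf.
Context {k : comPzRingType}.
Variable H : bialgType k.

Definition is_antipode (S : {linear H -> H}) : Prop := forall x : H,
  tmult (tmap S idfun (comul x)) = (counit x)%:A /\
  tmult (tmap idfun S (comul x)) = (counit x)%:A.

Definition is_hopf_algebra : Prop := exists S, is_antipode S.

Definition cocommutative : Prop := forall x : H, tswap (comul x) = comul x.

Definition proper_quantum_group : Prop :=
  [/\ is_hopf_algebra, ~ commutative ( *%R : H -> H -> H) & ~ cocommutative].

End Hopf.

Record algebra_coaction (k : comPzRingType) (H : bialgType k) (A : algType k) :=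
  AlgebraCoaction {
    coact :> {linear A -> (A ⊗ H)%type};
    coact_monoid_morphism : monoid_morphism coact;
    coactA : forall a : A,
      tassoc (tmap coact idfun (coact a)) = tmap idfun comul (coact a);
    coact_counit : forall a : A, trunit (tmap idfun counit (coact a)) = a
  }.

Definition regular_coaction (k : comPzRingType) (H : bialgType k) :
    algebra_coaction H H :=
  AlgebraCoaction (@comul_monoid_morphism k H) (@comulA k H) (@counitr k H).

Section HopfGalois.
Context {k : comPzRingType} {H : bialgType k} {A : algType k}.
Variable delta : algebra_coaction H A.

Definition coinv : {pred A} := [pred a | delta a == a ⊗ 1].

Lemma coinv_subalg : subalg_closed coinv.
Proof.
have [d1 dM] := coact_monoid_morphism delta.
split=> [|c a b /eqP da /eqP db|a b /eqP da /eqP db]; apply/eqP.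
- by rewrite d1.
- by rewrite linearP da db tensDl tensZl.
- by rewrite dM da db tensM mulr1.
Qed.

(* A tensored with itself over B = A^{co H}: [b \o* idfun] is a |-> a b and
   [b \*o idfun] is c |-> b c. *)
Definition tensor_coinv : Type :=
  @btens k A A {b : A | b \in coinv}
    (fun b => val b \o* idfun) (fun b => val b \*o idfun).

HB.instance Definition _ := GRing.Lmodule.on tensor_coinv.

Definition tens_coinv (a c : A) : tensor_coinv := pure _ _ a c.

Definition can (x : tensor_coinv) : A ⊗ H :=
  lift (fun a c => (a ⊗ 1) * delta c) x.

Lemma can_balanced :
  balanced (fun b : {b : A | b \in coinv} => val b \o* idfun)
    (fun b => val b \*o idfun) (fun a c => (a ⊗ 1) * delta c).
Proof.
have [_ dM] := coact_monoid_morphism delta.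
split=> [a a' c|a c c'|a [b /= /eqP db] c].
- by rewrite tensDl mulrDl.
- by rewrite linearD mulrDr.
- by rewrite dM db mulrA tensM mulr1.
Qed.

Lemma can_tens (a c : A) : can (tens_coinv a c) = (a ⊗ 1) * delta c.
Proof. exact: lift_pure can_balanced a c. Qed.

Lemma can_linear : linear can.
Proof.
move=> c x y; rewrite /can (liftD can_balanced) -!/(can _); congr (_ + _).
elim/(@btens_ind k A A {b : A | b \in coinv} (fun b => val b \o* idfun) (fun b => val b \*o idfun)): x
    => [|x1 x2 e1 e2|a b].
- by rewrite scaler0 /can (lift0 can_balanced) scaler0.
- by rewrite scalerDr /can !(liftD can_balanced) -!/(can _) e1 e2 scalerDr.
rewrite -/(tens_coinv a b) (_ : _ *: _ = tens_coinv (c *: a) b); last first.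
  by rewrite /tens_coinv pureZl.
rewrite !can_tens tensZl.
elim/(@tensor_ind k A H): (delta b) => [|y1 y2 e1 e2|a' h].
- by rewrite !mulr0 scaler0.
- by rewrite !mulrDr e1 e2 scalerDr.
- by rewrite -tensZl !tensM -scalerAl tensZl.
Qed.

(* B need not be given as a subset of A: it is identified with A^{co H} along
   the embedding [iota], as k is with k . 1_H when A = H. *)
Definition hopf_galois_extension (B : pzRingType) (iota : {rmorphism B -> A}) :
    Prop :=
  [/\ injective iota, forall a, a \in coinv <-> exists b, a = iota b &
      bijective can].

End HopfGalois.

(* Main.v *)
(** The translation map x ⊗ h ↦ x S(h_(1)) ⊗ h_(2) inverts the canonical map:
    both composites reduce, by coassociativity, to the antipode and counit
    axioms, once k-scalars may cross the tensor product over the coinvariants.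
    The counit identifies these coinvariants with k: if Δ(a) = a ⊗ 1, applying
    ε ⊗ id gives a = ε(a) 1. *)

Require Import Defs.
From HB Require Import structures.
From mathcomp Require Import all_boot all_algebra.

Set Implicit Arguments.
Unset Strict Implicit.
Unset Printing Implicit Defensive.

Import GRing.Theory.
Local Open Scope ring_scope.

(** * Additive maps out of tensor products, and Sweedler calculus for them *)

Section TensorLift.
Context {k : comPzRingType}.
Implicit Types M N : lmodType k.

(** Pure tensors generate [M ⊗ N] additively, so additivity of [h] is enough; the target [P] can
    then be any abelian group. *)
Lemma tlift_unique M N (P : zmodType) (f : M -> N -> P) (h : M ⊗ N -> P) :
    kbalanced f -> {morph h : x y / x + y} ->
  (forall m n, h (m ⊗ n) = f m n) -> h =1 tlift f.
Proof.
move=> fb hD ht; elim/(@tensor_ind k M N)=> [|x y ex ey|m n].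
- by rewrite tlift0 //; apply: (addrI (h 0)); rewrite -hD !addr0.
- by rewrite hD tliftD // ex ey.
- by rewrite tlift_tens.
Qed.

Lemma kbalanced_compl M M' N (P : zmodType) (f : M -> N -> P)
    (g : {linear M' -> M}) :
  kbalanced f -> kbalanced (fun m n => f (g m) n).
Proof.
case=> Dl Dr bal; split=> [m m' n|m n n'|m c n] /=.
- by rewrite linearD Dl.
- exact: Dr.
- by rewrite linearZ /= bal.
Qed.

Lemma kbalanced_compr M N N' (P : zmodType) (f : M -> N -> P)
    (g : {linear N' -> N}) :
  kbalanced f -> kbalanced (fun m n => f m (g n)).
Proof.
case=> Dl Dr bal; split=> [m m' n|m n n'|m c n] /=.
- exact: Dl.
- by rewrite linearD Dr.
- by rewrite linearZ /= bal.
Qed.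

Lemma tmapD M M' N N' (f : {linear M -> M'}) (g : {linear N -> N'}) :
  {morph tmap f g : x y / x + y}.
Proof. by apply: tliftD; apply: tmap_balanced. Qed.

Lemma tassocD L M N : {morph @tassoc k L M N : x y / x + y}.
Proof. by apply: tliftD; apply: tassoc_balanced. Qed.

Section Trilinear.
Variables (L M N : lmodType k) (P : zmodType) (f : L -> M -> N -> P).
Hypothesis fbr : forall x, kbalanced (f x).
Hypothesis fbl : forall z, kbalanced (fun x y => f x y z).

Lemma kbalanced_tliftr : kbalanced (fun x t => tlift (f x) t).
Proof.
split=> [x x' t|x t t'|x c t] /=.
(* All three lifts are sums over the same representative of [t], so they can be compared
   termwise. *)
- rewrite /tlift /Defs.lift -big_split; apply: eq_bigr => -[y z] _ /=.
  exact: (balDl (fbl z)).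
- exact: tliftD.
- elim/(@tensor_ind k M N): t => [|t t' e e'|y z].
  + by rewrite scaler0 !tlift0.
  + by rewrite scalerDr !tliftD // e e'.
  + by rewrite -tensZl !tlift_tens //; exact: (bal_act (fbl z)).
Qed.

Lemma kbalanced_tliftl : kbalanced (fun t z => tlift (fun x y => f x y z) t).
Proof.
split=> [t t' z|t z z'|t c z] /=.
- exact: tliftD.
- rewrite /tlift /Defs.lift -big_split; apply: eq_bigr => -[x y] _ /=.
  exact: (balDr (fbr x)).
- elim/(@tensor_ind k L M): t => [|t t' e e'|x y].
  + by rewrite scaler0 !tlift0.
  + by rewrite scalerDr !tliftD // e e'.
  + by rewrite -tensZr !tlift_tens //; exact: (bal_act (fbr x)).
Qed.

End Trilinear.

(** Coassociativity in Sweedler form: $\sum f(b_{(1)}, b_{(2)}, b_{(3)})$ does not depend on which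
    leg of $\Delta(b)$ is split again. *)
Lemma tlift_comulA (C : coalgType k) (P : zmodType) (f : C -> C -> C -> P) b :
    (forall x, kbalanced (f x)) -> (forall z, kbalanced (fun x y => f x y z)) ->
  tlift (fun w z => tlift (fun x y => f x y z) (comul w)) (comul b)
  = tlift (fun x w => tlift (f x) (comul w)) (comul b).
Proof.
move=> fbr fbl.
have br := kbalanced_tliftr fbr fbl.
have bl := kbalanced_tliftl fbr fbl.
(* [F] is the map induced by [f] on $C \otimes (C \otimes C)$; the two sides are its values at the
   two sides of [comulA]. *)
pose F := tlift (fun x t => tlift (f x) t).
have FA y : F (tassoc y) = tlift (fun t z => tlift (fun x y => f x y z) t) y.
  apply: (tlift_unique (h := F \o @tassoc k C C C) bl) => [t t'|t z] /=.
    by rewrite tassocD /F tliftD.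
  (* Here [t] is still an arbitrary element of $C \otimes C$, so uniqueness is used again with [z]
     fixed. *)
  apply: (tlift_unique (h := fun t => F (tassoc (t ⊗ z))) (fbl z))
    => [s s'|x y'].
    by rewrite tensDl tassocD /F tliftD.
  by rewrite tassoc_tens /F !tlift_tens.
have <- : F (tmap idfun comul (comul b))
    = tlift (fun x w => tlift (f x) (comul w)) (comul b).
  apply: (tlift_unique (h := F \o tmap idfun comul)
    (kbalanced_compr comul br)) => [t t'|x w] /=.
    by rewrite tmapD /F tliftD.
  by rewrite tmap_tens /F tlift_tens.
rewrite -comulA FA; apply/esym.
apply: (tlift_unique (h := tlift _ \o tmap comul idfun)
  (kbalanced_compl comul bl)) => [t t'|w z] /=.
  by rewrite tmapD tliftD.
by rewrite tmap_tens tlift_tens.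
Qed.

(** The left counit axiom under an additive map. As [f] is not assumed $k$-linear, the scalar stays
    inside its argument. *)
Lemma tlift_counitl (C : coalgType k) (P : zmodType) (f : C -> P) b :
    {morph f : x y / x + y} ->
  tlift (fun w z => f ((counit w : k) *: z)) (comul b) = f b.
Proof.
move=> fD; rewrite -[in RHS](counitl b).
have lb : kbalanced (fun (c : k^o) (z : C) => (c : k) *: z).
  split=> [c d x|c x y|c d x]; first exact: scalerDl.
  - exact: scalerDr.
  - by rewrite scalerA mulrC.
apply/esym; apply: (tlift_unique (h := f \o (tlunit (M := C) \o tmap counit idfun))) => [|t t'|w z] /=.
- have [Dl Dr bal] := kbalanced_compl (counit : {linear C -> k^o}) lb.
  split=> [m m' n|m n n'|m c n] /=; first by rewrite -fD -Dl.
  + by rewrite -fD -Dr.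
  + by congr f; exact: bal.
- by rewrite tmapD /tlunit (tliftD lb) fD.
- by rewrite tmap_tens tlunit_tens.
Qed.

(** Serves to recognise one side of the antipode axiom inside a larger Sweedler sum. *)
Lemma tmult_tmap (A : algType k) (P : zmodType) (f g : {linear A -> A})
    (h : A -> P) t :
    {morph h : x y / x + y} ->
  tlift (fun x y => h (f x * g y)) t = h (tmult (tmap f g t)).
Proof.
move=> hD; apply/esym.
have mb : kbalanced ( *%R : A -> A -> A).
  split=> [x y z|x y z|x c z] /=; rewrite ?mulrDl ?mulrDr //.
  by rewrite -scalerAl -scalerAr.
apply: (tlift_unique (h := h \o (@tmult _ A \o tmap f g)))
  => [|s s'|x y] /=.
- split=> [x y z|x y z|x c z] /=.
  + by rewrite linearD mulrDl hD.
  + by rewrite linearD mulrDr hD.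
  + by rewrite !linearZ /= -scalerAl -scalerAr.
- by rewrite tmapD /tmult (tliftD mb) hD.
- by rewrite tmap_tens tmult_tens.
Qed.

End TensorLift.

(** * Coinvariants of the regular coaction *)

Section RegularCoaction.
Context {k : comPzRingType}.
Variable H : bialgType k.
Local Notation delta := (regular_coaction H).

Lemma coinv_regularP (a : H) : a \in coinv delta <-> exists c : k, a = c%:A.
Proof.
have [comul1 _] := @comul_monoid_morphism k H.
split=> [/eqP /= da | [c ->]]; last first.
  by apply/eqP; rewrite /= linearZ /= comul1 tensZl.
exists (counit a); rewrite -[LHS]counitl [comul a]da.
by rewrite tmap_tens tlunit_tens.
Qed.

(** The counit is a retraction of the unit map, since $\varepsilon(c 1) = c$. *)
Lemma in_alg_inj : injective (in_alg H).
Proof.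
have [counit1 _] := @counit_monoid_morphism k H.
move=> c d /(congr1 (@counit k H)); rewrite !linearZ /= counit1.
by rewrite /GRing.scale /= !mulr1.
Qed.

(** The relations defining this tensor product move coinvariant elements only; a scalar crosses as
    the coinvariant $c 1_H$. *)
Lemma tens_coinvZ c (a b : H) :
  tens_coinv delta (c *: a) b = tens_coinv delta a (c *: b).
Proof.
have cP : c%:A \in coinv delta by apply/coinv_regularP; exists c.
have := @pure_bal k H H {b : H | b \in coinv delta}
  (fun b => val b \o* idfun) (fun b => val b \*o idfun) a (exist (fun x => x \in coinv delta) _ cP) b.
by rewrite /= -scalerAl -scalerAr mul1r mulr1.
Qed.

Lemma tens_coinvDl (a a' b : H) :
  tens_coinv delta (a + a') b = tens_coinv delta a b + tens_coinv delta a' b.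
Proof. exact: pureDl. Qed.

Lemma tens_coinvDr (a b b' : H) :
  tens_coinv delta a (b + b') = tens_coinv delta a b + tens_coinv delta a b'.
Proof. exact: pureDr. Qed.

(** * The translation map and its two composites with the canonical map *)

Section Translation.
Variable S : {linear H -> H}.

Definition translation : H ⊗ H -> tensor_coinv delta :=
  tlift (fun a h => tlift (fun u v => tens_coinv delta (a * S u) v) (comul h)).

Lemma translation_balanced_in a :
  kbalanced (fun u v => tens_coinv delta (a * S u) v).
Proof.
split=> [x y z|x y z|x c z] /=.
- by rewrite linearD mulrDr tens_coinvDl.
- exact: tens_coinvDr.
- by rewrite linearZ /= -scalerAr tens_coinvZ.
Qed.

Lemma translation_balanced_out v :
  kbalanced (fun a u => tens_coinv delta (a * S u) v).
Proof.
split=> [x y z|x y z|x c z] /=.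
- by rewrite mulrDl tens_coinvDl.
- by rewrite linearD mulrDr tens_coinvDl.
- by rewrite linearZ /= -scalerAr -scalerAl.
Qed.

Lemma translation_balanced : kbalanced (fun a h =>
  tlift (fun u v => tens_coinv delta (a * S u) v) (comul h)).
Proof.
exact: (kbalanced_compr comul (kbalanced_tliftr
  translation_balanced_in translation_balanced_out)).
Qed.

Hypothesis S_antipode : is_antipode S.

(** On pure tensors: $a S(h_{(1)}) h_{(2)} \otimes h_{(3)} = a \varepsilon(h_{(1)}) \otimes h_{(2)}
    = a \otimes h$. *)
Lemma translationK : cancel translation (can (delta := delta)).
Proof.
have canD : {morph can (delta := delta) : x y / x + y}.
  exact: (liftD (can_balanced delta)).
elim/(@tensor_ind k H H)=> [|x y ex ey|a h].
- rewrite /translation (tlift0 translation_balanced).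
  exact: (Defs.lift0 (can_balanced delta)).
- by rewrite /translation (tliftD translation_balanced) canD ex ey.
rewrite /translation (tlift_tens translation_balanced).
pose f x y z : H ⊗ H := (a * (S x * y)) ⊗ z.
have fbr x : kbalanced (f x).
  split=> [p q r|p q r|p c r] /=; rewrite /f.
  + by rewrite !mulrDr tensDl.
  + by rewrite tensDr.
  + by rewrite -!scalerAr tensZl tensZr.
have fbl z : kbalanced (fun x y => f x y z).
  split=> [p q r|p q r|p c r] /=; rewrite /f.
  + by rewrite linearD mulrDl mulrDr tensDl.
  + by rewrite !mulrDr tensDl.
  + by rewrite linearZ /= -scalerAl -!scalerAr.
transitivity (tlift (fun x w => tlift (f x) (comul w)) (comul h)).
  apply: (tlift_unique (h := can (delta := delta) \o tlift _)) => [|t t'|u v] /=.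
  + exact: (kbalanced_compr comul (kbalanced_tliftr fbr fbl)).
  + by rewrite (tliftD (translation_balanced_in a)) canD.
  rewrite (tlift_tens (translation_balanced_in a)) can_tens /=.
  apply: (tlift_unique (h := fun t => (a * S u) ⊗ 1 * t) (fbr u))
    => [t t'|y z]; first by rewrite mulrDr.
  by rewrite tensM mul1r /f mulrA.
rewrite -tlift_comulA //.
(* Expanding $h$ as $\varepsilon(h_{(1)}) h_{(2)}$ makes both sides sums over the same
   representative of [comul h]. *)
rewrite -[in RHS](tlift_counitl (f := fun z => a ⊗ z)); last first.
  by move=> y z; exact: tensDr.
rewrite /tlift /Defs.lift; apply: eq_bigr => -[w z] _ /=.
transitivity ((a * tmult (tmap S idfun (comul w))) ⊗ z).
  apply: (tmult_tmap S idfun (h := fun y => (a * y) ⊗ z)) => p q.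
  by rewrite mulrDr tensDl.
by rewrite (S_antipode w).1 -scalerAr mulr1 tensZl tensZr.
Qed.

(** With $B$ the coinvariants: $a b_{(1)} S(b_{(2)}) \otimes_B b_{(3)} = a \varepsilon(b_{(1)})
    \otimes_B b_{(2)} = a \otimes_B b$, by the other antipode identity. *)
Lemma canK : cancel (can (delta := delta)) translation.
Proof.
have canD : {morph can (delta := delta) : x y / x + y}.
  exact: (liftD (can_balanced delta)).
have trD : {morph translation : x y / x + y} := tliftD translation_balanced.
elim/(@btens_ind k H H {b : H | b \in coinv delta}
    (fun b => val b \o* idfun) (fun b => val b \*o idfun))
  => [|x y ex ey|a b].
- rewrite /can (Defs.lift0 (can_balanced delta)).
  exact: (tlift0 translation_balanced).
- by rewrite canD trD ex ey.
rewrite -/(tens_coinv delta a b) can_tens /=.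
pose f x y z := tens_coinv delta (a * (x * S y)) z.
have fbr x : kbalanced (f x).
  split=> [p q r|p q r|p c r] /=; rewrite /f.
  + by rewrite linearD !mulrDr tens_coinvDl.
  + by rewrite tens_coinvDr.
  + by rewrite linearZ /= -!scalerAr tens_coinvZ.
have fbl z : kbalanced (fun x y => f x y z).
  split=> [p q r|p q r|p c r] /=; rewrite /f.
  + by rewrite mulrDl mulrDr tens_coinvDl.
  + by rewrite linearD !mulrDr tens_coinvDl.
  + by rewrite linearZ /= -scalerAl -!scalerAr.
transitivity (tlift (fun x w => tlift (f x) (comul w)) (comul b)).
  apply: (tlift_unique (h := fun t => translation (a ⊗ 1 * t)))
    => [|t t'|u v] /=.
  + exact: (kbalanced_compr comul (kbalanced_tliftr fbr fbl)).
  + by rewrite mulrDr trD.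
  rewrite tensM mul1r /translation (tlift_tens translation_balanced).
  by rewrite /tlift /Defs.lift; apply: eq_bigr => -[y z] _ /=; rewrite /f mulrA.
rewrite -tlift_comulA //.
rewrite -[in RHS](tlift_counitl (f := tens_coinv delta a)); last first.
  by move=> y z; exact: tens_coinvDr.
rewrite /tlift /Defs.lift; apply: eq_bigr => -[w z] _ /=.
transitivity (tens_coinv delta (a * tmult (tmap idfun S (comul w))) z).
  apply: (tmult_tmap idfun S (h := fun y => tens_coinv delta (a * y) z)) => p q.
  by rewrite mulrDr tens_coinvDl.
(* The antipode leaves the scalar $\varepsilon(w)$ on the left factor, whence it crosses to [z]. *)
by rewrite (S_antipode w).2 -scalerAr mulr1 tens_coinvZ.
Qed.

End Translation.
End RegularCoaction.

Theorem corollary5p6 (k : comPzRingType) (H : bialgType k)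
    (HQ : proper_quantum_group H) :
  hopf_galois_extension (regular_coaction H) (in_alg H).
Proof.
have [[S antS] _ _] := HQ.
split; [exact: in_alg_inj | exact: coinv_regularP |].
exact: Bijective (canK antS) (translationK antS).
Qed.
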